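(* Let $H$ be a finite dimensional Hilbert space, let $M=M_n$, and let $K$ be a mapping cone in $\mathcal P(H)$. Let $\mathcal P_K(M)^\flat$ be the dual cone of the cone $\mathcal P_K(M)$ of $K$-positive maps. Let $\phi\in B(M,H)$. Then the following conditions are equivalent. (i) $\phi\in \mathcal P_K(M)^\flat$. (ii) $C_\phi\in P(M,K^t)$. (iii) $\tilde\phi\circ(\iota\otimes\alpha^* )\ge 0$ for all $\alpha\in K$. (iv) $\alpha\circ\phi\in CP(M,H)$ for all $\alpha\in K^t$.
   Context: $M=M_n$ is the algebra of complex $n\times n$ matrices with standard matrix units $(e_{ij})$, and $H$ is a finite dimensional complex Hilbert space. $t$ denotes the transpose map on $M$ and on $B(H)$ (with respect to a fixed orthonormal basis of $H$); $x^t=t(x)$. $\iota$ is the identity map and $Tr$ the usual trace on $M$, $B(H)$ or $M\otimes B(H)$. $B(M,H)$ is the set of linear maps $M\to B(H)$; $B(M,H)^+$ and $CP(M,H)$ are the positive, respectively completely positive, maps in it. $\mathcal P(H)=B(B(H),H)^+$ is the set of positive linear maps $B(H)\to B(H)$. A mapping cone is a nonzero closed (convex) cone $K\subset\mathcal P(H)$ such that $\phi\in K$ and $a,b\in B(H)$ imply that $x\mapsto a\phi(bxb^* )a^*$ belongs to $K$. $P(M,K)=\{x\in M\otimes B(H): (\iota\otimes\alpha)(x)\ge0\ \forall\alpha\in K\}$. For $\phi\in B(M,H)$, $\tilde\phi$ is the linear functional on $M\otimes B(H)$ with $\tilde\phi(a\otimes b)=Tr(\phi(a)b^t)$. A map $\phi\in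 B(M,H)^+$ is $K$-positive if $\tilde\phi$ is positive (i.e. takes values $\ge 0$) on $P(M,K)$; $\mathcal P_K(M)$ is the cone of $K$-positive maps. The Choi matrix is $C_\phi=\sum_{ij}e_{ij}\otimes\phi(e_{ij})\in M\otimes B(H)$. For $S\subset B(M,H)^+$ its dual cone is $S^\flat=\{\phi\in B(M,H): Tr(C_\phi C_\psi)\ge0\ \forall\psi\in S\}$. $\phi^t=t\circ\phi\circ t$ and $K^t=\{\phi^t:\phi\in K\}$ (again a mapping cone). $\alpha^*$ is the adjoint of $\alpha$, determined by $Tr(\alpha(a)b)=Tr(a\alpha^*(b))$. A linear functional is written $\ge0$ if it is nonnegative on positive operators. *)

(* Defs.v *)
From HB Require Import structures.
From mathcomp Require Import all_boot all_order all_algebra.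
From mathcomp Require Import complex mxtens.
From mathcomp Require Import boolp classical_sets reals topology normedtype.

Set Implicit Arguments.
Unset Strict Implicit.
Unset Printing Implicit Defensive.

Import Order.TTheory GRing.Theory Num.Theory.
Import numFieldNormedType.Exports.

Local Open Scope classical_set_scope.
Local Open Scope ring_scope.
Local Open Scope sesquilinear_scope.

(* H is C^m with its standard orthonormal basis, B(H) is 'M[C]_m, M = M_n is
   'M[C]_n, B(M, H) is 'Hom('M[C]_n, 'M[C]_m), and M (x) B(H) is 'M[C]_(n * m)
   with the Kronecker product *t. The definitions make sense over any
   C : numClosedFieldType, where 0 <= z says that z is real and nonnegative. *)

Section TensorProduct.
Variable C : numClosedFieldType.

(* For bilinear f, the unique linear map on M_p (x) M_q sending a (x) b to
   f a b: see tens_liftE and tens_lift_uniq. *)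
Definition tens_lift p q (V : lmodType C) (f : 'M[C]_p -> 'M[C]_q -> V)
    (x : 'M[C]_(p * q)) : V :=
  \sum_i \sum_j \sum_k \sum_l
    x (mxtens_index (i, k)) (mxtens_index (j, l)) *:
      f (delta_mx i j) (delta_mx k l).

Lemma tens_lift_is_linear p q (V : lmodType C) (f : 'M[C]_p -> 'M[C]_q -> V) :
  linear (tens_lift f).
Proof.
move=> a x y; rewrite /tens_lift.
do 4![rewrite scaler_sumr -big_split; apply: eq_bigr => ? _ /=].
by rewrite !mxE scalerDl scalerA.
Qed.

Lemma tens_liftE p q (V : lmodType C) (f : 'M[C]_p -> 'M[C]_q -> V) :
    (forall b, linear (f^~ b)) -> (forall a, linear (f a)) ->
  forall a b, tens_lift f (a *t b) = f a b.
Proof.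
move=> lf1 lf2 a b.
pose f1 b : {linear 'M[C]_p -> V} := HB.pack (f^~ b)
  (GRing.isLinear.Build _ _ _ _ (f^~ b) (lf1 b)).
pose f2 a : {linear 'M[C]_q -> V} := HB.pack (f a)
  (GRing.isLinear.Build _ _ _ _ (f a) (lf2 a)).
rewrite [in RHS](matrix_sum_delta a) -[f _ b]/(f1 b _) linear_sum.
apply: eq_bigr => i _; rewrite linear_sum; apply: eq_bigr => j _.
rewrite linearZ /= [in RHS](matrix_sum_delta b) -[f _ (\sum_i _)]/(f2 _ _).
rewrite linear_sum scaler_sumr; apply: eq_bigr => k _.
rewrite linear_sum scaler_sumr; apply: eq_bigr => l _.
by rewrite linearZ /= scalerA tensmxE.
Qed.

Lemma matrix_sum_tens p q (x : 'M[C]_(p * q)) :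
  x = \sum_i \sum_j \sum_k \sum_l
    x (mxtens_index (i, k)) (mxtens_index (j, l)) *:
      (delta_mx i j *t delta_mx k l).
Proof.
apply/matrixP => u v.
case: (mxtens_indexP u) => i k; case: (mxtens_indexP v) => j l.
rewrite summxE (bigD1 i) //= summxE (bigD1 j) //= summxE (bigD1 k) //=.
rewrite summxE (bigD1 l) //= mxE tensmxE !mxE !eqxx /= !mulr1.
rewrite !big1 ?addr0 // => [i' ni|j' nj|k' nk|l' nl].
- rewrite summxE big1 // => j' _; rewrite summxE big1 // => k' _.
  rewrite summxE big1 // => l' _.
  by rewrite mxE tensmxE !mxE eq_sym (negbTE ni) mul0r mulr0.
- rewrite summxE big1 // => k' _; rewrite summxE big1 // => l' _.
  by rewrite mxE tensmxE !mxE (eq_sym j) (negbTE nj) andbF mul0r mulr0.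
- rewrite summxE big1 // => l' _.
  by rewrite mxE tensmxE !mxE (eq_sym k) (negbTE nk) !mulr0.
- by rewrite mxE tensmxE !mxE (eq_sym l) (negbTE nl) andbF !mulr0.
Qed.

Lemma tens_lift_uniq p q (V : lmodType C) (f : 'M[C]_p -> 'M[C]_q -> V)
    (g : {linear 'M[C]_(p * q) -> V}) :
  (forall a b, g (a *t b) = f a b) -> g =1 tens_lift f.
Proof.
move=> gf x; rewrite [in LHS](matrix_sum_tens x) linear_sum.
do 3![apply: eq_bigr => ? _; rewrite linear_sum].
by apply: eq_bigr => ? _; rewrite linearZ /= gf.
Qed.

End TensorProduct.

Section PositiveMaps.
Variable C : numClosedFieldType.

Definition psd p (A : 'M[C]_p) : Prop :=
  forall v : 'cV[C]_p, 0 <= (v ^t* *m A *m v) 0 0.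

Definition positive_map p q (f : 'M[C]_p -> 'M[C]_q) : Prop :=
  forall x, psd x -> psd (f x).

Definition nonneg_functional p (f : 'M[C]_p -> C) : Prop :=
  forall x, psd x -> 0 <= f x.

(* iota (x) alpha, where iota is the identity map of M_p. *)
Definition ampl p q r (alpha : 'Hom('M[C]_q, 'M[C]_r)) :
    'M[C]_(p * q) -> 'M[C]_(p * r) :=
  tens_lift (fun (a : 'M[C]_p) (b : 'M[C]_q) => a *t alpha b).

Definition completely_positive p q (phi : 'Hom('M[C]_p, 'M[C]_q)) : Prop :=
  forall k, positive_map (@ampl k p q phi).

(* alpha^*: testing Tr (alpha a *m b) = Tr (a *m alpha^* b) on a = e_ji gives
   the entry (i, j) of alpha^* b. *)
Definition adjoint_fun p q (alpha : 'Hom('M[C]_p, 'M[C]_q)) (b : 'M[C]_q) :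
    'M[C]_p :=
  \matrix_(i, j) \tr (alpha (delta_mx j i) *m b).

Definition adjoint p q (alpha : 'Hom('M[C]_p, 'M[C]_q)) :
    'Hom('M[C]_q, 'M[C]_p) :=
  linfun (adjoint_fun alpha).

Definition transpose_map p q (phi : 'Hom('M[C]_p, 'M[C]_q)) :
    'Hom('M[C]_p, 'M[C]_q) :=
  (linfun trmx \o phi \o linfun trmx)%VF.

Definition choi p q (phi : 'Hom('M[C]_p, 'M[C]_q)) : 'M[C]_(p * q) :=
  \sum_i \sum_j delta_mx i j *t phi (delta_mx i j).

Definition tilde p q (phi : 'Hom('M[C]_p, 'M[C]_q)) : 'M[C]_(p * q) -> C :=
  @tens_lift C p q C^o (fun a b => \tr (phi a *m b^T)).

End PositiveMaps.

Section MapTheory.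
Variable C : numClosedFieldType.

Lemma amplE p q r (alpha : 'Hom('M[C]_q, 'M[C]_r)) (a : 'M[C]_p) b :
  ampl alpha (a *t b) = a *t alpha b.
Proof.
rewrite /ampl tens_liftE // => [c k x y|c k x y]; apply/matrixP => u v.
- by rewrite !mxE mulrDl mulrA.
- by rewrite linearP !mxE mulrDr mulrCA.
Qed.

Lemma tildeE p q (phi : 'Hom('M[C]_p, 'M[C]_q)) a b :
  tilde phi (a *t b) = \tr (phi a *m b^T).
Proof.
rewrite /tilde tens_liftE // => c k x y.
- by rewrite linearP mulmxDl -scalemxAl linearP.
- by rewrite linearP mulmxDr -scalemxAr linearP.
Qed.

Lemma adjoint_fun_is_linear p q (alpha : 'Hom('M[C]_p, 'M[C]_q)) :
  linear (adjoint_fun alpha).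
Proof.
move=> k x y; apply/matrixP => i j.
by rewrite !mxE mulmxDr -scalemxAr mxtraceD mxtraceZ.
Qed.

HB.instance Definition _ p q (alpha : 'Hom('M[C]_p, 'M[C]_q)) :=
  GRing.isLinear.Build _ _ _ _ (adjoint_fun alpha)
    (adjoint_fun_is_linear alpha).

Lemma adjointE p q (alpha : 'Hom('M[C]_p, 'M[C]_q)) a b :
  \tr (alpha a *m b) = \tr (a *m adjoint alpha b).
Proof.
rewrite lfunE /= {1}(matrix_sum_delta a) linear_sum mulmx_suml linear_sum /=.
rewrite /mxtrace; apply: eq_bigr => i _; rewrite mxE linear_sum mulmx_suml /=.
rewrite -/(\tr _) linear_sum /=; apply: eq_bigr => j _.
by rewrite linearZ /= -scalemxAl mxtraceZ mxE.
Qed.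

Lemma transpose_mapE p q (phi : 'Hom('M[C]_p, 'M[C]_q)) x :
  transpose_map phi x = (phi x^T)^T.
Proof. by rewrite !comp_lfunE !lfunE. Qed.

End MapTheory.

Section Cones.
Variable C : numClosedFieldType.

(* The topology is that of pointwise convergence, which on the finite
   dimensional space of linear maps is the only Hausdorff vector space
   topology. *)
Definition closed_maps p q (K : set 'Hom('M[C]_p, 'M[C]_q)) : Prop :=
  closed ((fun alpha : 'Hom('M[C]_p, 'M[C]_q) =>
             (fun x => alpha x) : {ptws 'M[C]_p -> 'M[C]_q}) @` K).

Definition convex_cone p q (K : set 'Hom('M[C]_p, 'M[C]_q)) : Prop :=
  (forall alpha beta, K alpha -> K beta -> K (alpha + beta)) /\
  (forall (c : C) alpha, 0 <= c -> K alpha -> K (c *: alpha)).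

Definition conj_fun m (a x : 'M[C]_m) : 'M[C]_m := a *m x *m a ^t*.

Lemma conj_fun_is_linear m (a : 'M[C]_m) : linear (conj_fun a).
Proof.
by move=> k x y; rewrite /conj_fun mulmxDr mulmxDl -scalemxAr -scalemxAl.
Qed.

HB.instance Definition _ m (a : 'M[C]_m) :=
  GRing.isLinear.Build _ _ _ _ (conj_fun a) (conj_fun_is_linear a).

Definition conj_map m (a b : 'M[C]_m) (phi : 'End('M[C]_m)) : 'End('M[C]_m) :=
  (linfun (conj_fun a) \o phi \o linfun (conj_fun b))%VF.

Lemma conj_mapE m (a b : 'M[C]_m) (phi : 'End('M[C]_m)) x :
  conj_map a b phi x = a *m phi (b *m x *m b ^t*) *m a ^t*.
Proof. by rewrite !comp_lfunE !lfunE. Qed.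

Record mapping_cone m (K : set 'End('M[C]_m)) : Prop := MappingCone {
  mapping_cone_positive : forall phi, K phi -> positive_map phi;
  mapping_cone_neq0 : exists2 phi, K phi & phi != 0;
  mapping_cone_closed : closed_maps K;
  mapping_cone_convex : convex_cone K;
  mapping_cone_stable : forall phi a b, K phi -> K (conj_map a b phi) }.

Definition P_cone n m (K : set 'End('M[C]_m)) : set 'M[C]_(n * m) :=
  [set x : 'M[C]_(n * m) |
    forall alpha, K alpha -> psd (ampl alpha x)].

Definition K_positive n m (K : set 'End('M[C]_m)) :
    set 'Hom('M[C]_n, 'M[C]_m) :=
  [set phi : 'Hom('M[C]_n, 'M[C]_m) |
    positive_map phi /\ forall x, P_cone K x -> 0 <= tilde phi x].

Definition dual_cone n m (S : set 'Hom('M[C]_n, 'M[C]_m)) :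
    set 'Hom('M[C]_n, 'M[C]_m) :=
  [set phi : 'Hom('M[C]_n, 'M[C]_m) |
    forall psi, S psi -> 0 <= \tr (choi phi *m choi psi)].

Definition transpose_cone m (K : set 'End('M[C]_m)) : set 'End('M[C]_m) :=
  [set transpose_map phi | phi in K].

End Cones.

(* Main.v *)
(* With C = C_phi, one has tilde phi x = Tr (C x^T), hence
   tilde phi ((iota (x) alpha^* ) y) = Tr ((iota (x) alpha) (C^T) y), and
   (iota (x) alpha^t) C is the transpose of (iota (x) alpha) (C^T). Since the
   cone of psd matrices is self-dual, (ii) and (iii) both say that C^T is in
   P(M, K); (iv) says the same by Choi's theorem, because
   (iota (x) alpha) C is the Choi matrix of alpha o phi.
   For (i) => (ii), the map psi with C_psi^T = (iota (x) alpha^* ) y is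
   K-positive for every alpha in K and psd y; it is a positive map because
   a (x) b is in P(M, K) when a and b are psd. Testing phi against these psi
   gives Tr ((iota (x) alpha) (C^T) y) >= 0. *)

From HB Require Import structures.
Require Import Defs.
From mathcomp Require Import all_boot all_order all_algebra.
From mathcomp Require Import complex mxtens.
From mathcomp Require Import boolp classical_sets reals topology normedtype.

Set Implicit Arguments.
Unset Strict Implicit.
Unset Printing Implicit Defensive.

Import Order.TTheory GRing.Theory Num.Theory.
Import numFieldNormedType.Exports.

Local Open Scope classical_set_scope.
Local Open Scope ring_scope.
Local Open Scope sesquilinear_scope.

(** * Positive semidefinite matrices and self-duality of their cone *)

Section PositiveSemidefinite.
Variable C : numClosedFieldType.

Lemma adjmxM p q r (A : 'M[C]_(p, q)) (B : 'M[C]_(q, r)) :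
  (A *m B)^t* = B^t* *m A^t*.
Proof. by rewrite trmx_mul map_mxM. Qed.

Lemma adjmxK p q (A : 'M[C]_(p, q)) : (A^t*)^t* = A.
Proof. by apply/matrixP=> i j; rewrite !mxE conjCK. Qed.

Lemma adjmx_tens p q r s (A : 'M[C]_(p, q)) (B : 'M[C]_(r, s)) :
  (A *t B)^t* = A^t* *t B^t*.
Proof. by rewrite trmx_tens map_mxT. Qed.

Lemma adjmxDZ p q (c : C) (A B : 'M[C]_(p, q)) :
  (A + c *: B)^t* = A^t* + c^* *: B^t*.
Proof. by apply/matrixP=> i j; rewrite !mxE rmorphD rmorphM. Qed.

(* Polarization: the cross terms of v = e_i + c e_j, for c = 1 and c = 'i. *)
Lemma quadratic_form_eq0 p (D : 'M[C]_p) :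
  (forall v : 'cV_p, (v^t* *m D *m v) 0 0 = 0) -> D = 0.
Proof.
move=> qD; apply/matrixP => i j; rewrite mxE.
have fE k l : (delta_mx k 0 : 'cV[C]_p)^t* *m D *m delta_mx l 0 = (D k l)%:M.
  by rewrite [LHS]mx11_scalar trmx_delta map_delta_mx -rowE -colE !mxE.
have D0 k : D k k = 0 by have := qD (delta_mx k 0); rewrite fE mxE.
have polar c : c * D i j + c^* * D j i = 0.
  have := qD (delta_mx i 0 + c *: delta_mx j 0).
  rewrite adjmxDZ !mulmxDl !mulmxDr -!scalemxAl -!scalemxAr !fE !D0 !mxE.
  by rewrite !mulr0 add0r addr0 !mulr1n.
have := polar 1; rewrite mul1r conjC1 mul1r => /eqP.
rewrite addr_eq0 => /eqP Dij.
have := polar 'i; rewrite conjCi Dij mulrN mulNr -opprD => /eqP.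
rewrite oppr_eq0 -mulr2n mulrn_eq0 /= mulf_eq0 (negPf (neq0Ci C)) /=.
by move=> /eqP ->; rewrite oppr0.
Qed.

(** In [C], [0 <= z] forces [z] to be real, so the form of [A] equals its own conjugate, which is
    the form of [A^t*]; the difference then vanishes by polarization. *)
Lemma psd_hermitian p (A : 'M[C]_p) : psd A -> A^t* = A.
Proof.
move=> psdA; apply/eqP; rewrite -subr_eq0; apply/eqP/quadratic_form_eq0 => v.
rewrite mulmxBr mulmxBl.
have -> : v^t* *m A^t* *m v = (v^t* *m A *m v)^t*.
  by rewrite !adjmxM adjmxK mulmxA.
move: (_ *m v) (psdA v) => a a_ge0.
by rewrite !mxE conj_Creal ?subrr ?ger0_real.
Qed.

Lemma psd_conj p q (A : 'M[C]_p) (W : 'M[C]_(p, q)) :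
  psd A -> psd (W^t* *m A *m W).
Proof. by move=> psdA v; have := psdA (W *m v); rewrite adjmxM !mulmxA. Qed.

Lemma psd_gram p q (B : 'M[C]_(p, q)) : psd (B^t* *m B).
Proof.
move=> v; rewrite mulmxA -adjmxM -mulmxA mxE; apply: sumr_ge0 => i _.
by rewrite !mxE mulrC mul_conjC_ge0.
Qed.

(** Spectral theorem: with [A = P^t* *m diag_mx d *m P] and [P] unitary, take for [B] the matrix [P]
    with its rows scaled by the square roots of [d]. *)
Lemma psd_factor p (A : 'M[C]_p) : psd A -> exists B : 'M_p, A = B^t* *m B.
Proof.
move=> psdA; have hA : A^t* = A := psd_hermitian psdA.
have /orthomx_spectralP : A \is normalmx by apply/normalmxP; rewrite hA.
move: (spectralmx A) (spectral_diag A) (spectral_unitarymx A) => P d Pu AE.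
rewrite invmx_unitary // in AE.
have diagE : P *m A *m P^t* = diag_mx d.
  rewrite AE !mulmxA (unitarymxP Pu) mul1mx -mulmxA (unitarymxP Pu).
  exact: mulmx1.
(* Each eigenvalue is the value of the form of [A] at [P^t*] applied to a basis vector. *)
have d_ge0 i : 0 <= d 0 i.
  have := psd_conj (P^t*) psdA (delta_mx i 0).
  by rewrite adjmxK diagE trmx_delta map_delta_mx -rowE -colE !mxE eqxx.
pose s := diag_mx (map_mx sqrtC d); exists (s *m P).
have sK : s^t* *m s = diag_mx d.
  rewrite tr_diag_mx map_diag_mx mulmx_diag; congr diag_mx.
  apply/rowP => j; rewrite !mxE /= conj_Creal ?ger0_real ?sqrtC_ge0 //.
  by rewrite -expr2 sqrtCK.
by rewrite adjmxM mulmxA -(mulmxA (P^t*)) sK.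
Qed.

Lemma psd_tens p q (A : 'M[C]_p) (B : 'M[C]_q) :
  psd A -> psd B -> psd (A *t B).
Proof.
move=> /psd_factor[X ->] /psd_factor[Y ->].
by rewrite -tensmx_mul -adjmx_tens; apply: psd_gram.
Qed.

(** The form of [A^T] at [v] is the form of [A] at the entrywise conjugate of [v], since a 1 x 1
    matrix is its own transpose. *)
Lemma psd_trmx p (A : 'M[C]_p) : psd A -> psd A^T.
Proof.
move=> psdA v; have := psdA (map_mx Num.conj v).
suff -> : (map_mx Num.conj v)^t* *m A *m map_mx Num.conj v =
    (v^t* *m A^T *m v)^T.
  by rewrite [X in _ <= X -> _]mxE.
rewrite !trmx_mul trmxK map_trmx -map_mx_comp (map_mx_id (@conjCK _)).
by rewrite map_trmx trmxK mulmxA.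
Qed.

(** With [A = X^t* *m X], cyclicity gives the trace of [X *m B *m X^t*], whose diagonal entries are
    values of the form of [B]. *)
Lemma mxtrace_mul_psd_ge0 p (A B : 'M[C]_p) :
  psd A -> psd B -> 0 <= \tr (A *m B).
Proof.
move=> /psd_factor[X ->] psdB; rewrite mxtrace_mulC mulmxA mxtrace_mulC mulmxA.
apply: sumr_ge0 => i _.
have := psd_conj (X^t*) psdB (delta_mx i 0).
by rewrite adjmxK trmx_delta map_delta_mx -rowE -colE !mxE.
Qed.

Lemma psd_mxtraceP p (A : 'M[C]_p) :
  psd A <-> (forall B, psd B -> 0 <= \tr (A *m B)).
Proof.
split=> [psdA B|trA v]; first exact: mxtrace_mul_psd_ge0.
(* Rank one matrices suffice as tests: the trace against [v *m v^t*] is the form of [A] at [v]. *)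
have := trA (v *m v^t*); rewrite -{1}[v]adjmxK => /(_ (psd_gram _)).
by rewrite mulmxA mxtrace_mulC mulmxA /mxtrace big_ord1.
Qed.

Lemma psd_trmxE p (A : 'M[C]_p) : psd A^T <-> psd A.
Proof. by split=> [/psd_trmx|]; [rewrite trmxK | exact: psd_trmx]. Qed.

End PositiveSemidefinite.

(** * Choi matrices, amplifications and Choi's theorem *)

Section ChoiMatrices.
Variable C : numClosedFieldType.

Lemma matrix_tens_ext p q p' q' (A B : 'M[C]_(p * q, p' * q')) :
  (forall i j k l, A (mxtens_index (i, k)) (mxtens_index (j, l)) =
                   B (mxtens_index (i, k)) (mxtens_index (j, l))) -> A = B.
Proof.
move=> AB; apply/matrixP => u v.
by case: (mxtens_indexP u) => i k; case: (mxtens_indexP v) => j l.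
Qed.

Lemma sum_mxtens_index (V : nmodType) p q (F : 'I_(p * q) -> V) :
  \sum_u F u = \sum_i \sum_k F (mxtens_index (i, k)).
Proof.
rewrite pair_bigA (reindex (@mxtens_index p q)) /=.
  by apply: eq_bigr => -[].
by exists (@mxtens_unindex p q) => u _;
  rewrite (mxtens_indexK, mxtens_unindexK).
Qed.

Lemma mxtrace_mul_tens p q (A B : 'M[C]_(p * q)) :
  \tr (A *m B) = \sum_i \sum_j \sum_k \sum_l
    A (mxtens_index (i, k)) (mxtens_index (j, l)) *
    B (mxtens_index (j, l)) (mxtens_index (i, k)).
Proof.
rewrite /mxtrace sum_mxtens_index; apply: eq_bigr => i _.
rewrite exchange_big; apply: eq_bigr => k _ /=.
by rewrite mxE sum_mxtens_index.
Qed.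

Lemma mxtrace_mul_delta p q (A : 'M[C]_(p, q)) i j :
  \tr (A *m delta_mx j i) = A i j.
Proof.
rewrite mxtrace_mulC /mxtrace (bigD1 j) //= big1 ?addr0 => [|k nk].
  rewrite mxE (bigD1 i) //= big1 ?addr0 => [|l nl].
    by rewrite mxE !eqxx mul1r.
  by rewrite mxE (negPf nl) andbF mul0r.
by rewrite mxE big1 // => l _; rewrite mxE (negPf nk) mul0r.
Qed.

Lemma choiE p q (phi : 'Hom('M[C]_p, 'M[C]_q)) i j k l :
  choi phi (mxtens_index (i, k)) (mxtens_index (j, l)) =
  phi (delta_mx i j) k l.
Proof.
rewrite summxE (bigD1 i) //= summxE (bigD1 j) //= tensmxE mxE !eqxx mul1r.
rewrite !big1 ?addr0 // => [i' ni|j' nj].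
  rewrite summxE big1 // => j' _.
  by rewrite tensmxE mxE eq_sym (negPf ni) mul0r.
by rewrite tensmxE mxE (eq_sym j) (negPf nj) andbF mul0r.
Qed.

(** Amplification acts blockwise: [alpha] is applied to the [(i, j)] block of [x]. The later
    identities are compared entry by entry through this formula. *)
Lemma ampl_entry p q r (alpha : 'Hom('M[C]_q, 'M[C]_r)) (x : 'M[C]_(p * q))
    i j k l :
  ampl alpha x (mxtens_index (i, k)) (mxtens_index (j, l)) =
  \sum_s \sum_t x (mxtens_index (i, s)) (mxtens_index (j, t)) *
    alpha (delta_mx s t) k l.
Proof.
rewrite summxE (bigD1 i) //= [X in _ + X]big1 ?addr0 => [|i' ni]; last first.
  rewrite summxE big1 // => j' _; rewrite summxE big1 // => s _.
  rewrite summxE big1 // => t _.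
  by rewrite mxE tensmxE mxE eq_sym (negPf ni) mul0r mulr0.
rewrite summxE (bigD1 j) //= [X in _ + X]big1 ?addr0 => [|j' nj]; last first.
  rewrite summxE big1 // => s _; rewrite summxE big1 // => t _.
  by rewrite mxE tensmxE mxE (eq_sym j) (negPf nj) andbF mul0r mulr0.
rewrite summxE; apply: eq_bigr => s _; rewrite summxE; apply: eq_bigr => t _.
by rewrite mxE tensmxE mxE !eqxx mul1r.
Qed.

Lemma tilde_choi p q (phi : 'Hom('M[C]_p, 'M[C]_q)) x :
  tilde phi x = \tr (choi phi *m x^T).
Proof.
rewrite mxtrace_mul_tens; do 4!apply: eq_bigr => ? _.
by rewrite trmx_delta mxtrace_mul_delta mxE choiE mulrC.
Qed.

(** [f] sends the matrix unit [(i, j)] to the [(i, j)] block of [y]. This lets test maps be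
    prescribed by their Choi matrices. *)
Lemma choi_surj p q (y : 'M[C]_(p * q)) :
  exists psi : 'Hom('M[C]_p, 'M[C]_q), choi psi = y.
Proof.
pose f (a : 'M[C]_p) : 'M[C]_q := \matrix_(k, l)
  \sum_i \sum_j a i j * y (mxtens_index (i, k)) (mxtens_index (j, l)).
have lf : linear f.
  move=> c a b; apply/matrixP => k l; rewrite !mxE mulr_sumr -big_split.
  apply: eq_bigr => i _; rewrite mulr_sumr -big_split; apply: eq_bigr => j _.
  by rewrite !mxE mulrDl mulrA.
pose g : {linear 'M[C]_p -> 'M[C]_q} :=
  HB.pack f (GRing.isLinear.Build _ _ _ _ f lf).
exists (linfun g); apply: matrix_tens_ext => i j k l.
rewrite choiE lfunE mxE (bigD1 i) //= (bigD1 j) //= mxE !eqxx mul1r.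
rewrite !big1 ?addr0 // => [i' ni|j' nj].
  by rewrite big1 // => j' _; rewrite mxE (negPf ni) mul0r.
by rewrite mxE (negPf nj) andbF mul0r.
Qed.

Lemma mxtrace_ampl_adjoint p q r (alpha : 'Hom('M[C]_q, 'M[C]_r))
    (x : 'M[C]_(p * q)) y :
  \tr (ampl alpha x *m y) = \tr (x *m ampl (adjoint alpha) y).
Proof.
rewrite !mxtrace_mul_tens; do 2!apply: eq_bigr => ? _.
rewrite !pair_bigA /=.
under eq_bigr do rewrite ampl_entry pair_bigA /= mulr_suml.
under [RHS]eq_bigr do rewrite ampl_entry exchange_big pair_bigA /= mulr_sumr.
rewrite exchange_big; apply: eq_bigr => -[s t] _; apply: eq_bigr => -[k l] _ /=.
by rewrite lfunE mxE mxtrace_mul_delta -mulrA [y _ _ * _]mulrC.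
Qed.

(** Transposing the whole tensor also swaps the outer indices; doing it before and after [alpha]
    cancels that swap and leaves only the inner transposes. *)
Lemma ampl_transpose_map p q r (alpha : 'Hom('M[C]_q, 'M[C]_r))
    (x : 'M[C]_(p * q)) :
  ampl (transpose_map alpha) x = (ampl alpha x^T)^T.
Proof.
apply: matrix_tens_ext => i j k l.
rewrite mxE !ampl_entry exchange_big; apply: eq_bigr => s _.
by apply: eq_bigr => t _; rewrite transpose_mapE !mxE trmx_delta.
Qed.

Lemma choi_comp p q r (phi : 'Hom('M[C]_p, 'M[C]_q))
    (alpha : 'Hom('M[C]_q, 'M[C]_r)) :
  choi (alpha \o phi)%VF = ampl alpha (choi phi).
Proof.
apply: matrix_tens_ext => i j k l; rewrite choiE ampl_entry comp_lfunE.
rewrite {1}(matrix_sum_delta (phi _)) linear_sum summxE; apply: eq_bigr => s _.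
rewrite linear_sum summxE; apply: eq_bigr => t _.
by rewrite linearZ mxE choiE.
Qed.

(** Each row of the factor [X] of the Choi matrix, reshaped into a [p] x [q] matrix, is a Kraus
    operator. *)
Lemma kraus_of_choi p q (phi : 'Hom('M[C]_p, 'M[C]_q)) :
  psd (choi phi) ->
  exists N (B : 'I_N -> 'M[C]_(p, q)),
    forall a, phi a = \sum_u (B u)^t* *m a *m B u.
Proof.
move=> /psd_factor[X choiX].
exists (p * q)%N, (fun u => \matrix_(r, k) X u (mxtens_index (r, k))) => a.
have phi_delta r s k l : phi (delta_mx r s) k l =
    \sum_u (X u (mxtens_index (r, k)))^* * X u (mxtens_index (s, l)).
  by rewrite -choiE choiX mxE; apply: eq_bigr => u _; rewrite !mxE.
apply/matrixP => k l; rewrite summxE.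
transitivity (\sum_s \sum_r a r s * phi (delta_mx r s) k l).
  rewrite {1}(matrix_sum_delta a) linear_sum summxE exchange_big.
  apply: eq_bigr => r _; rewrite linear_sum summxE; apply: eq_bigr => s _.
  by rewrite linearZ mxE.
under eq_bigr => s _.
  under eq_bigr => r _ do rewrite phi_delta mulr_sumr.
  rewrite exchange_big /=.
  over.
rewrite exchange_big; apply: eq_bigr => u _ /=.
rewrite mxE; apply: eq_bigr => s _; rewrite mxE mulr_suml.
by apply: eq_bigr => r _; rewrite !mxE mulrA [a r s * _]mulrC.
Qed.

(** Both sides are linear in [x] and agree on elementary tensors. *)
Lemma ampl_kraus p q r N (B : 'I_N -> 'M[C]_(q, r))
    (phi : 'Hom('M[C]_q, 'M[C]_r)) :
  (forall a, phi a = \sum_u (B u)^t* *m a *m B u) ->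
  forall x : 'M[C]_(p * q),
    ampl phi x = \sum_u (1%:M *t B u)^t* *m x *m (1%:M *t B u).
Proof.
move=> phiE x.
pose f (x : 'M[C]_(p * q)) : 'M[C]_(p * r) :=
  \sum_u (1%:M *t B u)^t* *m x *m (1%:M *t B u).
have lf : linear f.
  move=> c a b; rewrite /f scaler_sumr -big_split; apply: eq_bigr => u _.
  by rewrite mulmxDr mulmxDl -scalemxAr -scalemxAl.
pose g : {linear 'M[C]_(p * q) -> 'M[C]_(p * r)} :=
  HB.pack f (GRing.isLinear.Build _ _ _ _ f lf).
rewrite -[RHS]/(g x); apply/esym/tens_lift_uniq => a b /=.
rewrite /f phiE.
have tens_sum (F : 'I_N -> 'M[C]_r) : a *t (\sum_u F u) = \sum_u a *t F u.
  apply/matrixP => i j; rewrite !mxE !summxE mulr_sumr.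
  by apply: eq_bigr => u _; rewrite mxE.
rewrite tens_sum; apply: eq_bigr => u _.
by rewrite adjmx_tens !tensmx_mul trmx1 map_mx1 mul1mx mulmx1.
Qed.

Lemma choi_id_psd p : psd (choi (\1%VF : 'End('M[C]_p))).
Proof.
(* [w] is the unnormalized maximally entangled vector, the sum of all [e_i] tensor [e_i]; the Choi
   matrix of the identity is [w *m w^t*]. *)
pose w : 'cV[C]_(p * p) :=
  \col_u ((mxtens_unindex u).1 == (mxtens_unindex u).2)%:R.
suff -> : choi \1%VF = (w^t*)^t* *m w^t* by apply: psd_gram.
apply: matrix_tens_ext => i j k l.
rewrite choiE id_lfunE adjmxK !mxE big_ord1 !mxE !mxtens_indexK /= conjC_nat.
by rewrite -natrM mulnb [k == i]eq_sym [l == j]eq_sym.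
Qed.

Lemma completely_positive_choi p q (phi : 'Hom('M[C]_p, 'M[C]_q)) :
  completely_positive phi <-> psd (choi phi).
Proof.
split=> [cp|/kraus_of_choi[N [B phiE]] k x psdx].
  (* The Choi matrix of [phi] is the amplification of [phi] at the psd Choi matrix of the
     identity. *)
  by rewrite -[phi]comp_lfun1r choi_comp; exact/cp/choi_id_psd.
rewrite (ampl_kraus phiE) => v; rewrite mulmx_sumr mulmx_suml summxE.
by apply: sumr_ge0 => u _; apply: psd_conj.
Qed.

End ChoiMatrices.

(** * The cycle (i), (ii), (iii), (iv), (i) *)

Theorem theorem1 (R : realType) (n m : nat) (K : set 'End('M[R[i]]_m))
    (phi : 'Hom('M[R[i]]_n, 'M[R[i]]_m)) :
  mapping_cone K ->
  [<-> dual_cone (K_positive K) phi;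
       P_cone (transpose_cone K) (choi phi);
       forall alpha, K alpha ->
         nonneg_functional (tilde phi \o ampl (adjoint alpha));
       forall alpha, transpose_cone K alpha ->
         completely_positive (alpha \o phi)%VF].
Proof.
move=> mcK.
have PKtE : P_cone (transpose_cone K) (choi phi) <-> P_cone K (choi phi)^T.
  split=> [PK alpha Ka|PK _ [alpha Ka <-]].
    by apply/psd_trmxE; rewrite -ampl_transpose_map; apply: PK; exists alpha.
  by rewrite ampl_transpose_map psd_trmxE; apply: PK.
have tildeE_adj alpha y :
    tilde phi (ampl (adjoint alpha) y) = \tr (ampl alpha (choi phi)^T *m y).
  rewrite mxtrace_ampl_adjoint tilde_choi -mxtrace_tr trmx_mul trmxK.
  exact: mxtrace_mulC.
tfae.
- move=> dual_phi; apply/PKtE => alpha Ka; apply/psd_mxtraceP => y psdy.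
  have [psi psiE] := choi_surj (ampl (adjoint alpha) y)^T.
  have tilde_psi x : tilde psi x = \tr (ampl alpha x *m y).
    by rewrite tilde_choi psiE -trmx_mul mxtrace_tr mxtrace_ampl_adjoint.
  rewrite mxtrace_ampl_adjoint -mxtrace_tr trmx_mul trmxK -psiE mxtrace_mulC.
  apply: dual_phi; split=> [a psda|x PKx]; last first.
    by rewrite tilde_psi; apply: mxtrace_mul_psd_ge0 => //; apply: PKx.
  (* Positivity of [psi a] is tested against [b]: the trace of [psi a *m b] is
     [tilde psi (a *t b^T)], that is, the trace of [(a *t alpha b^T) *m y]. *)
  apply/psd_mxtraceP => b psdb.
  rewrite -[b]trmxK -tildeE tilde_psi amplE.
  apply: mxtrace_mul_psd_ge0 => //; apply: psd_tens => //.
  exact/(mapping_cone_positive mcK)/psd_trmx.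
- move=> /PKtE PK alpha Ka y psdy; rewrite /= tildeE_adj.
  by apply: mxtrace_mul_psd_ge0 => //; apply: PK.
- move=> tilde_ge0 _ [alpha Ka <-]; apply/completely_positive_choi.
  rewrite choi_comp ampl_transpose_map; apply/psd_trmxE/psd_mxtraceP => y psdy.
  by rewrite -tildeE_adj; apply: tilde_ge0.
(* By Choi's theorem (iv) puts the transpose of [choi phi] in [P_cone K], and [tilde psi] at that
   point is the trace pairing of [psi] with [phi]. *)
- move=> cp psi [_ psi_ge0].
  rewrite mxtrace_mulC -[choi phi]trmxK -tilde_choi.
  apply/psi_ge0/PKtE => alpha Ka.
  by rewrite -choi_comp; apply/completely_positive_choi/cp.
Qed.
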